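(* Let $\mathcal{P}$ be a finite 2-dimensional poset and let $\sigma,\overline{\sigma}$ be a diametral pair of linear extensions of $\mathcal{P}$. Then $L_\sigma,L_{\overline{\sigma}}$ is a diametral pair of linear extensions of the downset lattice $\mathcal{D}_\mathcal{P}$.
   Context: $\mathcal{P}$ is 2-dimensional if it has a realizer $\{L_1,L_2\}$: two linear extensions whose common comparabilities are exactly those of $\mathcal{P}$. $\mathcal{D}_\mathcal{P}$ is the poset of downsets of $\mathcal{P}$ ordered by inclusion. For a linear extension $\sigma$ of $\mathcal{P}$, $L_\sigma$ is the linear order on downsets with $A^{\downarrow}<B^{\downarrow}$ iff $\max_\sigma(A\triangle B)\in B$, where $A,B$ are the antichains of maximal elements and $\max_\sigma S$ is the $\sigma$-largest element of $S$. The distance between two linear extensions is the number of unordered pairs appearing in different orders in them; a diametral pair is a pair of linear extensions of maximum distance. *)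

(* Defs.v *)
From HB Require Import structures.
From mathcomp Require Import all_boot all_order.

Set Implicit Arguments.
Unset Strict Implicit.
Unset Printing Implicit Defensive.

(* Linear orders are represented by their reflexive relation [L : rel T]. *)
Definition linear_extension (d : Order.disp_t) (T : porderType d)
    (L : rel T) : Prop :=
  [/\ total L, antisymmetric L, transitive L &
      forall x y : T, (x <= y)%O -> L x y].

Definition realizer2 (d : Order.disp_t) (T : porderType d)
    (L1 L2 : rel T) : Prop :=
  [/\ linear_extension L1, linear_extension L2 &
      forall x y : T, (x <= y)%O = L1 x y && L2 x y].

(* [L1] and [L2] may coincide, so chains are included. *)
Definition two_dimensional (d : Order.disp_t) (T : porderType d) : Prop :=
  exists L1 L2 : rel T, realizer2 L1 L2.

Definition reversed_pairs (T : finType) (L1 L2 : rel T) : {set {set T}} :=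
  [set [set p.1; p.2] |
    p in [set p : T * T | [&& p.1 != p.2, L1 p.1 p.2 & L2 p.2 p.1]]].

Definition linext_dist (T : finType) (L1 L2 : rel T) : nat :=
  #|reversed_pairs L1 L2|.

Definition diametral_pair (d : Order.disp_t) (T : finPOrderType d)
    (L1 L2 : rel T) : Prop :=
  [/\ linear_extension L1, linear_extension L2 &
      forall M1 M2 : rel T, linear_extension M1 -> linear_extension M2 ->
        linext_dist M1 M2 <= linext_dist L1 L2].

Definition is_downset (d : Order.disp_t) (T : finPOrderType d) (D : {set T}) :
    bool :=
  [forall x in D, forall y : T, (y <= x)%O ==> (y \in D)].

Record downset (d : Order.disp_t) (T : finPOrderType d) := Downset {
  downset_set :> {set T};
  downsetP : is_downset downset_set
}.

HB.instance Definition _ (d : Order.disp_t) (T : finPOrderType d) :=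
  [isSub for @downset_set d T].
HB.instance Definition _ (d : Order.disp_t) (T : finPOrderType d) :=
  [Finite of downset T by <:].

Definition downset_le (d : Order.disp_t) (T : finPOrderType d) : rel (downset T) :=
  fun D E => (D : {set T}) \subset (E : {set T}).

Lemma downset_le_refl (d : Order.disp_t) (T : finPOrderType d) :
  reflexive (@downset_le d T).
Proof. by move=> D; exact: subxx. Qed.

Lemma downset_le_anti (d : Order.disp_t) (T : finPOrderType d) :
  antisymmetric (@downset_le d T).
Proof. by move=> D E H; apply/val_inj/eqP; rewrite eqEsubset. Qed.

Lemma downset_le_trans (d : Order.disp_t) (T : finPOrderType d) :
  transitive (@downset_le d T).
Proof. by move=> D E F; exact: subset_trans. Qed.

HB.instance Definition _ (d : Order.disp_t) (T : finPOrderType d) :=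
  Order.Le_isPOrder.Build Order.SetSubsetOrder.subset_display (downset T)
    (@downset_le_refl d T) (@downset_le_anti d T) (@downset_le_trans d T).

Definition maximals (d : Order.disp_t) (T : finPOrderType d) (D : {set T}) :
    {set T} :=
  [set x in D | [forall y in D, ~~ (x < y)%O]].

Definition symdiff (T : finType) (A B : {set T}) : {set T} :=
  (A :\: B) :|: (B :\: A).

(* [None] exactly when [S] is empty, provided [s] is a linear order. *)
Definition max_wrt (T : finType) (s : rel T) (S : {set T}) : option T :=
  [pick x in S | [forall y in S, s y x]].

Definition downset_linext_lt (d : Order.disp_t) (T : finPOrderType d)
    (s : rel T) : rel (downset T) :=
  fun D E =>
    if max_wrt s (symdiff (maximals D) (maximals E)) is Some x
    then x \in maximals E else false.

Definition downset_linext (d : Order.disp_t) (T : finPOrderType d)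
    (s : rel T) : rel (downset T) :=
  fun D E => (D == E) || downset_linext_lt s D E.

(* Main.v *)
Require Import Defs.
From HB Require Import structures.
From mathcomp Require Import all_boot all_order.
From mathcomp Require Import zify.

Import Order.POrderTheory.

Set Implicit Arguments.
Unset Strict Implicit.
Unset Printing Implicit Defensive.

(* The lexicographic order [L_s] compares two downsets [D], [E] by the
   [s]-largest element of their symmetric difference [S].  Group the pairs
   [(D, E)] by their meet and join: a fibre is parametrised by [X = D :\: E],
   which ranges over the unions of connected components of [S].  For an arbitrary
   pair of linear extensions [M1], [M2], the sets [X] with [D] before [E] in [M1]
   form a down-closed half of this Boolean algebra, and those with [E] before [D]
   in [M2] an up-closed half, so by Kleitman's inequality at most a quarter of the
   [X] are reversed.  A diametral pair [s], [t] of a 2-dimensional poset is a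
   realizer; then the [s]-maximum and the [t]-maximum of a disconnected [S] lie in
   different components, so [L_s], [L_t] reverse exactly a quarter. *)

(** * Rings of sets and Kleitman's inequality *)

(** No top element is demanded, so the members disjoint from a fixed set form a ring again. *)
Definition set_ring (T : finType) (B : {set {set T}}) : Prop :=
  {in B &, forall X Y, X :|: Y \in B /\ X :\: Y \in B}.

Definition closed_below (T : finType) (B F : {set {set T}}) : Prop :=
  {in B &, forall X Y : {set T}, X \subset Y -> Y \in F -> X \in F}.

Definition closed_above (T : finType) (B G : {set {set T}}) : Prop :=
  {in B &, forall X Y : {set T}, X \subset Y -> X \in G -> Y \in G}.

Lemma set_ring_setI (T : finType) (B : {set {set T}}) X Y :
  set_ring B -> X \in B -> Y \in B -> X :&: Y \in B.
Proof.
move=> rB BX BY; have -> : X :&: Y = X :\: (X :\: Y).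
  by apply/setP=> z; rewrite !inE; case: (z \in X); case: (z \in Y).
by apply: (rB _ _ _ _).2 => //; apply: (rB _ _ _ _).2.
Qed.

(** The hypotheses make [a] an atom of [B]; removing [a] matches the members containing it with
    members missing it. *)
Lemma card_set_ring_split (T : finType) (B H : {set {set T}}) (a : {set T}) :
    let B0 := [set X in B | a :&: X == set0] in
    set_ring B -> a \in B -> {in B, forall X, a :&: X == set0 \/ a \subset X} ->
    a != set0 -> H \subset B ->
  #|H| = #|[set X in B0 | X \in H]| + #|[set X in B0 | a :|: X \in H]|.
Proof.
move=> B0 rB Ba ata a0 /subsetP HB.
rewrite -(cardsID B0 H); congr (_ + _).
  by apply: eq_card => X; rewrite !inE andbC.
rewrite -[RHS](card_in_imset (f := fun X => a :|: X)).
  apply: eq_card => X; apply/idP/imsetP => [|[Y]].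
    rewrite !inE => /andP[nX XH]; have BX := HB _ XH.
    move: nX; rewrite BX /= => nX.
    have aX : a \subset X by case: (ata X BX) => // e; rewrite e in nX.
    have e : a :|: X :\: a = X.
      by apply/setP=> z; rewrite !inE; case za: (z \in a) => //=;
        rewrite (subsetP aX).
    exists (X :\: a); rewrite ?e // !inE e XH (rB _ _ _ _).2 //= andbT.
    by apply/eqP/setP=> z; rewrite !inE; case: (z \in a).
  rewrite !inE => /andP[/andP[BY aY] HY] ->; rewrite HY andbT negb_and.
  by rewrite HB //=; apply: contraNneq a0 => <-; apply/eqP/setP=> z;
    rewrite !inE; case: (z \in a).
move=> X Y;
  rewrite !inE => /andP[/andP[_ /eqP aX] _] /andP[/andP[_ /eqP aY] _] /setP e.
apply/setP=> z; have := e z; move/setP/(_ z): aX; move/setP/(_ z): aY.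
by rewrite !inE; case: (z \in a) => //= -> ->.
Qed.

(* Kleitman's correlation inequality; the induction splits [B] according to
   whether a set contains a fixed atom [a], which gives two copies of a
   smaller ring. *)
Lemma kleitman (T : finType) (B F G : {set {set T}}) :
    set_ring B -> F \subset B -> G \subset B ->
    closed_below B F -> closed_above B G ->
  #|B| * #|F :&: G| <= #|F| * #|G|.
Proof.
have [n] := ubnP #|B|; elim: n => // n IHn in B F G *.
rewrite ltnS => leBn rB FB GB dF uG.
have [/existsP[a0 a0P]|] := boolP [exists a, (a \in B) && (a != set0)];
  last first.
  rewrite negb_exists => /forallP noa.
  (* Only the empty set can belong to [B], so all cardinalities involved are at most 1. *)
  have B1 : #|B| <= 1.
    rewrite -(cards1 (set0 : {set T})) subset_leq_card //.
    by apply/subsetP=> X BX; move: (noa X); rewrite BX inE negbK.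
  have [->|] := posnP #|F :&: G|; first by rewrite muln0.
  have := subset_leq_card (subsetIl F G); have := subset_leq_card (subsetIr F G).
  by have := subset_leq_card FB; have := subset_leq_card GB; nia.
(* A smallest nonempty member is an atom, because its intersections with members are members. *)
case: (@arg_minnP _ a0 (fun a => (a \in B) && (a != set0)) (fun a => #|a|)) =>
  // a /andP[Ba nza] mina.
have ata : {in B, forall X, a :&: X == set0 \/ a \subset X}.
  move=> X BX; case: eqVneq => [|nz]; [by left | right].
  have := mina (a :&: X); rewrite nz set_ring_setI // => /(_ isT) le.
  by apply/setIidPl/eqP; rewrite eqEcard subsetIl.
pose B0 := [set X in B | a :&: X == set0].
have B0B X : X \in B0 -> X \in B by rewrite inE => /andP[].
have B0a X : X \in B0 -> a :|: X \in B by move=> /B0B BX; apply: (rB _ _ _ _).1.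
have rB0 : set_ring B0.
  move=> X Y; rewrite !inE => /andP[BX /eqP aX] /andP[BY /eqP aY].
  have [-> ->] := rB _ _ BX BY; split=> /=.
    by rewrite setIUr aX aY setU0.
  by rewrite setIDA aX set0D.
have ltB : #|B0| < #|B|.
  apply: proper_card; apply/properP; split; first by apply/subsetP.
  by exists a; rewrite // inE setIid (negPf nza) andbF.
have splitB := @card_set_ring_split _ B _ a rB Ba ata nza.
pose F0 := [set X in B0 | X \in F]; pose F1 := [set X in B0 | a :|: X \in F].
pose G0 := [set X in B0 | X \in G]; pose G1 := [set X in B0 | a :|: X \in G].
have cF : #|F| = #|F0| + #|F1| by apply: splitB.
have cG : #|G| = #|G0| + #|G1| by apply: splitB.
have cB : #|B| = #|B0| + #|B0|.
  rewrite {1}splitB //; congr (_ + _); apply: eq_card => X; rewrite !inE.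
    by case: (X \in B); rewrite /= ?andbT.
  by case: (boolP (X \in B)) => BX //=; rewrite (rB _ _ _ _).1 // andbT.
have cFG : #|F :&: G| = #|F0 :&: G0| + #|F1 :&: G1|.
  rewrite (splitB (F :&: G)); last by apply: subset_trans FB; apply: subsetIl.
  by congr (_ + _); apply: eq_card => X; rewrite !inE; case: (X \in B);
    case: (_ == set0).
have IH (F' G' : {set {set T}}) : F' \subset B0 -> G' \subset B0 -> closed_below B0 F' ->
    closed_above B0 G' -> #|B0| * #|F' :&: G'| <= #|F'| * #|G'|.
  by apply: IHn => //; apply: leq_trans ltB leBn.
have subB0 (p : pred {set T}) : [set X in B0 | p X] \subset B0.
  by apply/subsetP=> X; rewrite inE => /andP[].
have IH0 : #|B0| * #|F0 :&: G0| <= #|F0| * #|G0|.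
  apply: IH; rewrite ?subB0 // => X Y X0 Y0 XY; rewrite inE => /andP[_ h];
    rewrite inE ?X0 ?Y0 /=.
    by apply: dF h; rewrite ?B0B.
  by apply: uG h; rewrite ?B0B.
have IH1 : #|B0| * #|F1 :&: G1| <= #|F1| * #|G1|.
  apply: IH; rewrite ?subB0 // => X Y X0 Y0 XY; rewrite inE => /andP[_ h];
    rewrite inE ?X0 ?Y0 /=.
    by apply: dF h; rewrite ?B0a // setUS.
  by apply: uG h; rewrite ?B0a // setUS.
have leF : #|F1| <= #|F0|.
  apply/subset_leq_card/subsetP=> X; rewrite inE => /andP[X0 h]; rewrite inE X0.
  by apply: dF h; rewrite ?B0a ?B0B ?subsetUr.
have leG : #|G0| <= #|G1|.
  apply/subset_leq_card/subsetP=> X; rewrite inE => /andP[X0 h]; rewrite inE X0.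
  by apply: uG h; rewrite ?B0a ?B0B ?subsetUr.
(* The two inductive bounds combine by Chebyshev's sum inequality, since [F] is larger on the half
   without [a] and [G] on the half with [a]. *)
rewrite cF cG cB cFG; move: IH0 IH1 leF leG.
by move: #|B0| #|F0| #|F1| #|G0| #|G1| #|_ :&: _| #|_ :&: _| => *; nia.
Qed.

(** * Fibre counting and maxima of linear orders *)

Lemma card_fibres (T U : finType) (f : T -> U) (A : {set T}) :
  #|A| = \sum_c #|[set x in A | f x == c]|.
Proof.
rewrite -sum1_card (partition_big f predT) //=.
by apply: eq_bigr => c _; rewrite sum1dep_card.
Qed.

Section LinearOrder.
Variables (T : finType) (s : rel T).
Hypotheses (tot : total s) (anti : antisymmetric s) (tr : transitive s).

Lemma exists_max (S : {set T}) :
  S != set0 -> exists2 x, x \in S & {in S, forall y, s y x}.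
Proof.
case/set0Pn=> x0 x0S.
(* Choose [x] with the most predecessors: an element above [x] has no further ones, yet precedes
   itself, so it precedes [x]. *)
case: (@arg_maxnP _ x0 (mem S) (fun x => #|[set y | s y x]|)) => // x xS maxx.
exists x => // y yS; case/orP: (tot y x) => // xy.
have refl z : s z z by have := tot z z; case: (s z z).
have sub : [set z | s z x] \subset [set z | s z y].
  by apply/subsetP=> z; rewrite !inE => zx; apply: tr xy.
have := maxx y yS; rewrite /= => le.
have /eqP/setP/(_ y) : [set z | s z x] == [set z | s z y] by rewrite eqEcard sub.
by rewrite !inE refl.
Qed.

Lemma max_wrtE (S : {set T}) (x : T) :
  x \in S -> {in S, forall y, s y x} -> max_wrt s S = Some x.
Proof.
move=> xS mx; rewrite /max_wrt; case: pickP => [z /andP[zS /forall_inP mz]|].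
  by congr Some; apply: anti; rewrite mx ?mz.
by move/(_ x); rewrite xS => /forall_inP[].
Qed.

End LinearOrder.

(** * Inversions and diametral pairs *)

Lemma set2_eqP (T : finType) (a b c e : T) :
  [set a; b] = [set c; e] -> (a = c /\ b = e) \/ (a = e /\ b = c).
Proof.
move=> /setP eq; have := eq a; have := eq b; have := eq c; have := eq e.
rewrite !inE !eqxx !orbT => /orP[]/eqP e1 /orP[]/eqP e2 /esym/orP[]/eqP e3;
  by move=> /esym/orP[]/eqP e4; subst; auto.
Qed.

Definition inversions (T : finType) (L1 L2 : rel T) : {set T * T} :=
  [set p : T * T | [&& p.1 != p.2, L1 p.1 p.2 & L2 p.2 p.1]].

(** Antisymmetry admits only one orientation of each reversed pair. *)
Lemma linext_distE (T : finType) (L1 L2 : rel T) :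
  antisymmetric L1 -> linext_dist L1 L2 = #|inversions L1 L2|.
Proof.
move=> anti; apply: card_in_imset => -[a b] [c e]; rewrite !inE /=.
move=> /and3P[nab ab _] /and3P[nce ce _] /set2_eqP[[-> ->] //|[ea eb]]; subst.
by case/eqP: nab; apply: anti; rewrite ab ce.
Qed.

(** Linear extensions reverse only incomparable pairs, and a realizer reverses all of them.
    Maximality thus forces [s] and [t] to reverse every incomparable pair too, so pairs on which
    they agree are comparable. *)
Lemma diametral_realizer (d : Order.disp_t) (P : finPOrderType d) (s t : rel P) :
  two_dimensional P -> diametral_pair s t -> realizer2 s t.
Proof.
case=> L1 [L2 [lL1 lL2 rL]] [ls lt diam]; split=> // x y.
have [_ anti_s _ ext_s] := ls; have [_ anti_t _ ext_t] := lt.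
pose I := [set [set p.1; p.2] | p in [set p : P * P | (p.1 >< p.2)%O]].
have sub : reversed_pairs s t \subset I.
  apply/subsetP=> _ /imsetP[[a b] /= + ->]; rewrite inE /= => /and3P[nab ab ba].
  apply/imsetP; exists (a, b); rewrite ?inE //=;
    apply: contra nab => /orP[le|le]; apply/eqP.
    by apply: anti_t; rewrite ba ext_t.
  by apply: anti_s; rewrite ab ext_s.
have sup : I \subset reversed_pairs L1 L2.
  apply/subsetP=> _ /imsetP[[a b] /= + ->]; rewrite inE /= => ninc.
  have nab : a != b by apply: contraNneq ninc => ->;
    rewrite /Order.comparable lexx.
  have [tot1 _ _ _] := lL1; have [tot2 _ _ _] := lL2.
  move: ninc; rewrite /Order.comparable negb_or !rL => /andP[n1 n2].
  case/orP: (tot1 a b) => l1.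
    rewrite l1 /= in n1; have := tot2 a b; rewrite (negPf n1) /= => l2.
    by apply/imsetP; exists (a, b); rewrite ?inE /= ?nab ?l1.
  rewrite l1 /= in n2; have := tot2 a b; rewrite (negPf n2) orbF => l2.
  by apply/imsetP; exists (b, a); rewrite ?inE /= 1?eq_sym ?nab ?l1 // setUC.
have eqI : reversed_pairs s t = I.
  apply/eqP; rewrite eqEcard sub (leq_trans (subset_leq_card sup)) //.
  exact: diam.
apply/idP/andP=> [le|[sxy txy]]; first by rewrite ext_s ?ext_t.
have [->|nxy] := eqVneq x y; first exact: lexx.
apply: contraT => nle.
have : [set x; y] \in I.
  apply/imsetP; exists (x, y) => //;
    rewrite inE /Order.comparable /= (negPf nle) /=.
  by apply: contra nxy => le; apply/eqP/anti_s; rewrite sxy ext_s.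
rewrite -eqI => /imsetP[[a b]];
  rewrite inE /= => /and3P[_ sab tba] /set2_eqP[[ea eb]|[ea eb]]; subst.
  by case/eqP: nxy; apply: anti_t; rewrite txy.
by case/eqP: nxy; apply: anti_s; rewrite sxy.
Qed.

(** * Symmetric differences and halving arguments *)

Lemma in_symdiff (T : finType) (A B : {set T}) x :
  (x \in symdiff A B) = ((x \in A) (+) (x \in B)).
Proof. by rewrite !inE; case: (x \in A); case: (x \in B). Qed.

Lemma symdiffC (T : finType) (A B : {set T}) : symdiff A B = symdiff B A.
Proof. by rewrite /symdiff setUC. Qed.

Lemma symdiffK (T : finType) (c : {set T}) :
  cancel (fun X : {set T} => symdiff X c) (fun X => symdiff X c).
Proof. by move=> X; apply/setP=> z; rewrite !in_symdiff addbK. Qed.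

Lemma symdiff_eq0 (T : finType) (A B : {set T}) : (symdiff A B == set0) = (A == B).
Proof. by rewrite /symdiff setU_eq0 !setD_eq0 eqEsubset. Qed.

(** The involution [symdiff X c] of [A] flips membership of [z]. *)
Lemma card_toggle (T : finType) (A : {set {set T}}) (c : {set T}) (z : T) :
    {in A, forall X, symdiff X c \in A} -> z \in c ->
  #|A| = 2 * #|[set X in A | z \in X]| /\ #|A| = 2 * #|[set X in A | z \notin X]|.
Proof.
move=> clA zc; have inj := can_inj (@symdiffK T c).
have le1 : #|[set X in A | z \in X]| <= #|[set X in A | z \notin X]|.
  rewrite -(card_imset _ inj); apply/subset_leq_card/subsetP=> _ /imsetP[X + ->].
  by rewrite [in X in X -> _]inE => /andP[XA zX];
    rewrite inE clA // in_symdiff zX zc.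
have le2 : #|[set X in A | z \notin X]| <= #|[set X in A | z \in X]|.
  rewrite -(card_imset _ inj); apply/subset_leq_card/subsetP=> _ /imsetP[X + ->].
  by rewrite [in X in X -> _]inE => /andP[XA zX];
    rewrite inE clA // in_symdiff (negPf zX) zc.
have := cardsID [set X : {set T} | z \in X] A.
have -> : A :&: [set X : {set T} | z \in X] = [set X in A | z \in X].
  by apply/setP=> X; rewrite !inE.
have -> : A :\: [set X : {set T} | z \in X] = [set X in A | z \notin X].
  by apply/setP=> X; rewrite !inE andbC.
by move: le1 le2; move: #|_| #|_| #|_|; lia.
Qed.

(** Complementation in [S] injects [F] into [B :\: F]. *)
Lemma card_half (T : finType) (B F : {set {set T}}) (S : {set T}) :
    {in B, forall X : {set T}, X \subset S /\ S :\: X \in B} -> F \subset B ->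
    {in F, forall X, S :\: X \notin F} ->
  2 * #|F| <= #|B|.
Proof.
move=> BC /subsetP FB nF.
have inj : {in F &, injective (fun X => S :\: X)}.
  move=> X Y XF YF /= /setP e; apply/setP=> z; have := e z; rewrite !inE.
  have [/subsetP/(_ z) + _] := BC X (FB X XF);
    have [/subsetP/(_ z) + _] := BC Y (FB Y YF).
  by case: (z \in X); case: (z \in Y); case: (z \in S) => // h1 h2;
    first [have := h1 isT | have := h2 isT].
rewrite -(cardsID F B) mul2n -addnn.
have -> : B :&: F = F by apply/setIidPr/subsetP.
rewrite leq_add2l -(card_in_imset inj);
  apply/subset_leq_card/subsetP=> _ /imsetP[X XF ->].
by rewrite inE nF // (BC X (FB X XF)).2.
Qed.

(** * The lexicographic order on downsets *)

Section DownsetOrder.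
Variables (d : Order.disp_t) (P : finPOrderType d).
Implicit Types (D E F : downset P) (s t : rel P) (S X W : {set P}).

Lemma downset_closed D (x y : P) :
  x \in (D : {set P}) -> (y <= x)%O -> y \in (D : {set P}).
Proof. by move=> xD;
  have /forall_inP/(_ x xD)/forallP/(_ y)/implyP := downsetP D. Qed.

(* The [s]-largest element of [D] and [E]'s symmetric difference is maximal in
   the downset containing it, so passing to the antichains of maximal elements
   does not change it. *)
Lemma downset_linextE s D E x :
    linear_extension s -> x \in symdiff D E -> {in symdiff D E, forall y, s y x} ->
  downset_linext s D E = (x \in (E : {set P})).
Proof.
case=> tot anti tr ext xS mx.
(* An element of [A] above [z] would be outside the downset [B], hence in the symmetric difference,
   beyond its maximum. *)
have max1 (A B : downset P) z : {in symdiff A B, forall y, s y z} ->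
    z \in (A : {set P}) -> z \notin (B : {set P}) -> z \in maximals A.
  move=> mz zA zB; rewrite inE zA; apply/forall_inP=> y yA; apply/negP=> lt_zy.
  have yB : y \notin (B : {set P}) by apply: contra zB => yB;
    apply: downset_closed (ltW lt_zy).
  have szy := mz y; rewrite in_symdiff yA (negPf yB) in szy.
  by have := lt_eqF lt_zy; rewrite (anti z y) ?eqxx // szy // ext // ltW.
(* If [y] lies in both downsets, it is below some [w] of [B] outside [A], and [s] puts [w] below
   [z]. *)
have bound (A B : downset P) z y : {in symdiff A B, forall y, s y z} ->
    y \in maximals A -> y \notin maximals B -> s y z.
  move=> mz; rewrite inE => /andP[yA /forall_inP my] nyB.
  case yB: (y \in (B : {set P})); last by apply: mz; rewrite in_symdiff yA yB.
  move: nyB; rewrite inE yB /= negb_forall => /existsP[w].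
  rewrite negb_imply negbK => /andP[wB lt_yw].
  have wA : w \notin (A : {set P}) by apply/negP=> /my; rewrite lt_yw.
  apply: (tr w); first by rewrite ext // ltW.
  by apply: mz; rewrite in_symdiff wB (negPf wA).
have mx' : {in symdiff E D, forall y, s y x} by rewrite symdiffC.
have neqDE : D != E.
  by apply: contraTneq xS => ->; rewrite in_symdiff addbb.
have mxE : max_wrt s (symdiff (maximals D) (maximals E)) = Some x.
  apply: max_wrtE => // [|y]; rewrite in_symdiff.
    move: xS; rewrite in_symdiff; case xD: (x \in (D : {set P}));
      case xE: (x \in (E : {set P})) => // _.
      by rewrite (max1 D E) ?xE // inE xE.
    by rewrite addbC (max1 E D) ?xD // inE xD.
  case yD: (y \in maximals D); case yE: (y \in maximals E) => // _.
    by apply: (bound D E); rewrite ?yE.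
  by apply: (bound E D); rewrite ?yD.
rewrite /downset_linext (negPf neqDE) /downset_linext_lt mxE /=.
apply/idP/idP=> [|xE]; first by rewrite inE => /andP[].
by apply: (max1 E D) => //; move: xS; rewrite in_symdiff xE; case: (x \in _).
Qed.

Lemma symdiff_max s D E : linear_extension s -> D != E ->
  exists2 x, x \in symdiff D E & {in symdiff D E, forall y, s y x}.
Proof. by case=> tot anti tr ext neq; apply: exists_max;
  rewrite // symdiff_eq0. Qed.

Lemma downset_linext_linear s :
  linear_extension s -> linear_extension (downset_linext s).
Proof.
move=> ls; have [tot anti tr ext] := ls.
have refl D : downset_linext s D D by rewrite /downset_linext eqxx.
split.
- move=> D E; have [->|neq] := eqVneq D E; first by rewrite refl.
  have [x xS mx] := symdiff_max ls neq.
  rewrite (downset_linextE ls xS mx) (@downset_linextE s E D x) // 1?symdiffC //.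
  by move: xS; rewrite in_symdiff orbC; case: (x \in _) => //=; case: (x \in _).
- move=> D E; apply: contraTeq => neq.
  have [x xS mx] := symdiff_max ls neq.
  rewrite (downset_linextE ls xS mx) (@downset_linextE s E D x) // 1?symdiffC //.
  by move: xS; rewrite in_symdiff; case: (x \in _) => //=; case: (x \in _).
- move=> E D F.
  have [-> //|nDE] := eqVneq D E; have [-> //|nEF] := eqVneq E F.
  have [-> //|nDF] := eqVneq D F.
  have [x xS mx] := symdiff_max ls nDE; have [y yS my] := symdiff_max ls nEF.
  have [z zS mz] := symdiff_max ls nDF.
  rewrite (downset_linextE ls xS mx) (downset_linextE ls yS my) (downset_linextE ls zS mz).
  (* Otherwise [x], [y], [z] are distinct, and each lies in a symmetric difference whose maximum is
     one of the other two; the largest of the three gives a contradiction. *)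
  move=> xE yF; apply: contraT => zF.
  have zx := mx z; have yx := mx y; have zy := my z; have xy := my x.
  have xz := mz x; have yz := mz y.
  move: xS yS zS zx yx zy xy xz yz;
    rewrite !in_symdiff xE yF (negPf zF) !(addbT, addbF, addTb, addFb).
  move=> nxD nyE zD; rewrite zD (negPf nxD) (negPf nyE) /= => zx yx zy xy xz yz.
  have nxy : x <> y by move=> e; rewrite -e xE in nyE.
  have nxz : x <> z by move=> e; rewrite e zD in nxD.
  have nyz : y <> z by move=> e; rewrite -e yF in zF.
  case xF: (x \in (F : {set P})) xy xz => /= xy xz.
    have sxz := xz isT; case zE: (z \in (E : {set P})) zx zy => /= zx zy.
      have szy := zy isT; case yD: (y \in (D : {set P})) yx yz => /= yx yz.
        by case: nxz; apply: anti; rewrite sxz (tr _ _ _ szy) // yx.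
      by case: nyz; apply: anti; rewrite szy yz.
    by case: nxz; apply: anti; rewrite sxz zx.
  have sxy := xy isT; case yD: (y \in (D : {set P})) yx yz => /= yx yz.
    by case: nxy; apply: anti; rewrite sxy yx.
  have syz := yz isT; case zE: (z \in (E : {set P})) zx zy => /= zx zy.
    by case: nyz; apply: anti; rewrite syz zy.
  by case: nxy; apply: anti; rewrite sxy (tr _ _ _ syz) // zx.
- move=> D E sDE; have [-> //|neq] := eqVneq D E.
  have [x xS mx] := symdiff_max ls neq; rewrite (downset_linextE ls xS mx).
  move: xS; rewrite in_symdiff; case xD: (x \in (D : {set P})) => //= _.
  exact: (subsetP (sDE : (D : {set P}) \subset E)).
Qed.

(** * Unions of components and their separation *)

(* The unions of connected components of the comparability graph on [S]. *)
Definition detached (S : {set P}) : {set {set P}} :=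
  [set X : {set P} | (X \subset S) &&
    [forall u in X, forall v in S, (u >=< v)%O ==> (v \in X)]].

Lemma detachedP S X :
  reflect (X \subset S /\ {in X & S, forall u v, (u >=< v)%O -> v \in X})
          (X \in detached S).
Proof.
rewrite inE; apply: (iffP andP) => -[sub cl]; split=> //.
  by move=> u v uX vS; apply/implyP; move: v vS; apply/forall_inP; move: u uX;
    apply/forall_inP.
by apply/forall_inP=> u uX; apply/forall_inP=> v vS; apply/implyP; apply: cl.
Qed.

Lemma detached_ring S : set_ring (detached S).
Proof.
move=> X Y /detachedP[sX cX] /detachedP[sY cY]; split; apply/detachedP; split.
- by rewrite subUset sX.
- move=> u v; rewrite !inE => /orP[uX|uY] vS uv; first by rewrite (cX u).
  by rewrite (cY u) ?orbT.
- by apply: subset_trans sX; apply: subsetDl.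
- move=> u v; rewrite !inE => /andP[nuY uX] vS uv; rewrite (cX u) // andbT.
  apply: contra nuY => vY; apply: (cY v); rewrite 1?comparable_sym //.
  exact: (subsetP sX).
Qed.

Lemma detached_full S : S \in detached S.
Proof. by apply/detachedP; split. Qed.

Lemma detachedC S X : X \in detached S -> S :\: X \in detached S.
Proof. by move=> BX; apply: (detached_ring _ _).2; rewrite ?detached_full. Qed.

Lemma detached_symdiff S X W :
  X \in detached S -> W \in detached S -> symdiff X W \in detached S.
Proof.
move=> BX BW; have rB := @detached_ring S.
by apply: (rB _ _ _ _).1; apply: (rB _ _ _ _).2.
Qed.

(* In the planar picture of the realizer, the elements of [S] outside the
   component of [z] lie either to the upper left or to the lower right of [z],
   and no comparability joins the two sides. *)
Lemma detached_separation_aux s t S W x y z :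
    realizer2 s t -> W \in detached S -> x \in S -> y \in S ->
    {in S, forall u, s u x} -> {in S, forall u, t u y} ->
    z \in W -> x \notin W -> y \notin W ->
  exists X0, [/\ X0 \in detached S, y \in X0 & x \notin X0].
Proof.
case=> -[tots antis trs exts] [tott antit trt extt] rel.
move=> /detachedP[sW cW] xS yS mx my zW xW yW; have zS := subsetP sW z zW.
have inc u : u \in S -> u \notin W -> ~~ (u >=< z)%O.
  by move=> uS; apply: contra => uz; apply: (cW z) => //; rewrite comparable_sym.
have opp u : u \in S -> u \notin W -> (s u z -> t z u) /\ (t z u -> s u z).
  move=> uS uW; have := inc u uS uW; rewrite /Order.comparable negb_or !rel.
  case/andP=> n1 n2; split=> h.
    by rewrite h /= in n1; have := tott u z; rewrite (negPf n1).
  by rewrite h andbT in n2; have := tots u z; rewrite (negPf n2) orbF.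
(* Outside [W], these elements precede [z] in [s] and follow it in [t]: the [t]-maximum [y] is one
   of them, the [s]-maximum [x] is not. *)
exists [set w in S :\: W | s w z]; split.
- apply/detachedP; split; first by apply/subsetP=> u;
  rewrite !inE => /andP[/andP[]].
  move=> u v; rewrite !inE => /andP[/andP[uW uS] suz] vS uv; rewrite vS andbT.
  have vW : v \notin W by apply: contra uW => vW; apply: (cW v) => //;
    rewrite comparable_sym.
  rewrite vW /=; apply: contraT => nvz.
  have szv : s z v by have := tots z v; rewrite (negPf nvz) orbF.
  have tvz : t v z.
    have := tott v z => /orP[] // tzv.
    by have := (opp v vS vW).2 tzv; rewrite (negPf nvz).
  (* Passing through [z], both orders put [u] and [v] in opposite positions, so comparability would
     force equality. *)
  have suv := trs _ _ _ suz szv; have tvu := trt _ _ _ tvz ((opp u uS uW).1 suz).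
  have e : u = v.
    by case/orP: uv => le; [apply: antit; rewrite tvu extt | apply: antis;
      rewrite suv exts].
  by rewrite -e suz in nvz.
- by rewrite !inE yW yS (opp y yS yW).2 // my.
- rewrite !inE negb_and orbC; apply/orP; left; apply/negP=> sxz.
  by move: xW; rewrite (_ : x = z) ?zW //; apply: antis; rewrite sxz mx.
Qed.

(** If [W] splits [x] from [y], then [W] or its complement serves; otherwise a point [z] on the side
    without them is used. *)
Lemma detached_separation s t S W x y :
    realizer2 s t -> W \in detached S -> x \in S -> y \in S ->
    {in S, forall u, s u x} -> {in S, forall u, t u y} ->
    W != set0 -> W != S ->
  exists X0, [/\ X0 \in detached S, y \in X0 & x \notin X0].
Proof.
move=> real BW xS yS mx my W0 WS.
have BC := detachedC BW.
case xW: (x \in W); case yW: (y \in W).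
- have /set0Pn[z zC] : S :\: W != set0.
    rewrite setD_eq0; apply: contra WS => sub; rewrite eqEsubset sub.
    by case/detachedP: BW => ->.
  by apply: (detached_separation_aux real BC xS yS mx my zC); rewrite inE ?xW ?yW.
- by exists (S :\: W); split; rewrite // !inE ?xW ?yW ?yS.
- by exists W; rewrite xW yW.
- have /set0Pn[z zW] := W0.
  by apply: (detached_separation_aux real BW xS yS mx my zW); rewrite ?xW ?yW.
Qed.

(** Toggling by [S] flips membership of [x]; toggling by [X0] flips [y] and leaves [x] alone. Each
    halves the count. *)
Lemma card_separated S X0 x y :
    x \in S -> X0 \in detached S -> y \in X0 -> x \notin X0 ->
  #|detached S| = 4 * #|[set X in detached S | (y \in X) && (x \notin X)]|.
Proof.
move=> xS B0 y0 x0.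
have cl : {in detached S, forall X, symdiff X S \in detached S}.
  by move=> X BX; apply: detached_symdiff; rewrite ?detached_full.
have [_ ->] := card_toggle cl xS.
pose A := [set X in detached S | x \notin X].
have clA : {in A, forall X, symdiff X X0 \in A}.
  move=> X; rewrite [in X in X -> _]inE => /andP[BX xX].
  by rewrite inE detached_symdiff // in_symdiff (negPf xX).
have [-> _] := card_toggle clA y0.
rewrite mulnA; congr (_ * _); apply: eq_card => X; rewrite !inE.
by case: (y \in X); rewrite ?andbT ?andbF.
Qed.

(** * Pairs of downsets with given meet and join *)

Definition meet_join (p : downset P * downset P) : {set P} * {set P} :=
  ((p.1 : {set P}) :&: p.2, (p.1 : {set P}) :|: p.2).

(* For [X] detached in the symmetric difference, [complete D0 E0 X] is the
   downset [(D0 :&: E0) :|: X]; for other [X] it may be the junk value [D0]. *)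
Definition complete D0 E0 X : downset P :=
  insubd D0 ((D0 : {set P}) :&: E0 :|: X).

(** An element below the union is absorbed by [X] if it lies in the symmetric difference, and
    otherwise lies in the meet. *)
Lemma completeE D0 E0 X : X \in detached (symdiff D0 E0) ->
  complete D0 E0 X = (D0 : {set P}) :&: E0 :|: X :> {set P}.
Proof.
move=> /detachedP[/subsetP sX cX].
rewrite -[LHS]/(val (complete D0 E0 X)) insubdK // unfold_in.
apply/forall_inP=> u uCX; apply/forallP=> v; apply/implyP=> le_vu.
case vS: (v \in symdiff D0 E0).
  case/setUP: uCX => [/setIP[uD uE]|uX].
    by move: vS; rewrite in_symdiff !(downset_closed _ le_vu).
  by apply/setUP; right; apply: (cX u) => //;
    rewrite /Order.comparable le_vu orbT.
have : v \in (D0 : {set P}) :|: E0.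
  have : u \in (D0 : {set P}) :|: E0.
    case/setUP: uCX => [/setIP[uD uE]|/sX]; first by rewrite inE uD.
    by rewrite in_symdiff inE; case: (u \in _).
  by case/setUP=> h; rewrite inE (downset_closed h le_vu) ?orbT.
by move: vS; rewrite in_symdiff !inE; case: (v \in _); case: (v \in _).
Qed.

Lemma meet_join_symdiff (p q : downset P * downset P) :
  meet_join p = meet_join q -> symdiff p.1 p.2 = symdiff q.1 q.2.
Proof.
case=> /setP eI /setP eU; apply/setP=> z; have := eI z; have := eU z.
rewrite !in_symdiff !inE.
by case: (z \in _); case: (z \in _); case: (z \in _); case: (z \in _).
Qed.

(** No element of [D :\: E] is comparable to one of [E :\: D]: the smaller would belong to both
    downsets. *)
Lemma setD_detached D E : (D : {set P}) :\: E \in detached (symdiff D E).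
Proof.
apply/detachedP; split; first exact: subsetUl.
move=> u v /setDP[uD uE]; rewrite in_symdiff inE => vS /orP[le_uv|le_vu].
  have vE : v \notin (E : {set P}) by apply: contra uE => vE;
    apply: downset_closed le_uv.
  by move: vS; rewrite (negPf vE) addbF.
by move: vS; rewrite (downset_closed uD le_vu) andbT.
Qed.

(** Together with [meet_join_complete] and [complete_inj], this parametrises the fibre of [(D0, E0)]
    by detached sets. *)
Lemma complete_setD D0 E0 D E : meet_join (D, E) = meet_join (D0, E0) ->
  complete D0 E0 ((D : {set P}) :\: E) = D /\
  complete D0 E0 (symdiff D0 E0 :\: (D :\: E)) = E.
Proof.
move=> e; have eS : symdiff D E = symdiff D0 E0 := meet_join_symdiff e.
have B1 := setD_detached D E; have B2 := detachedC B1; rewrite eS in B1 B2.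
case: e => eI _.
split; apply/val_inj; rewrite /= completeE // -?eS -eI; apply/setP=> z;
  rewrite !inE;
  by case: (z \in (D : {set P})); case: (z \in (E : {set P})).
Qed.

Lemma meet_join_complete D0 E0 X : X \in detached (symdiff D0 E0) ->
  meet_join (complete D0 E0 X, complete D0 E0 (symdiff D0 E0 :\: X)) =
    meet_join (D0, E0).
Proof.
move=> BX; rewrite /meet_join /= !completeE ?detachedC //.
have [/subsetP sX _] := detachedP _ _ BX.
by congr (_, _); apply/setP=> z; have := sX z; rewrite !inE;
  case: (z \in X) => [/(_ isT)|_];
  case: (z \in (D0 : {set P})); case: (z \in (E0 : {set P})).
Qed.

Lemma complete_subset D0 E0 X W :
    X \in detached (symdiff D0 E0) -> W \in detached (symdiff D0 E0) ->
  X \subset W -> (complete D0 E0 X <= complete D0 E0 W)%O.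
Proof.
move=> BX BW sXW; rewrite -[(_ <= _)%O]/((complete D0 E0 X : {set P}) \subset _).
by rewrite !completeE // setUS.
Qed.

Lemma complete_inj D0 E0 :
  {in detached (symdiff D0 E0) &, injective (complete D0 E0)}.
Proof.
move=> X W BX BW e;
  have /setP {}e : (complete D0 E0 X : {set P}) = complete D0 E0 W.
  by rewrite e.
have [/subsetP sX _] := detachedP _ _ BX;
  have [/subsetP sW _] := detachedP _ _ BW.
apply/setP=> z; have := e z; rewrite !completeE // !inE.
case CZ: ((z \in (D0 : {set P})) && (z \in (E0 : {set P}))) => //= _.
have nS : z \notin symdiff D0 E0 by case/andP: CZ => zD zE;
  rewrite in_symdiff zD zE.
by apply/idP/idP=> [/sX|/sW]; rewrite (negPf nS).
Qed.

(** * Counting inversions in one fibre *)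

Lemma card_inversions_fibre_le (M1 M2 : rel (downset P)) D0 E0 :
    linear_extension M1 -> linear_extension M2 -> D0 != E0 ->
  4 * #|[set p in inversions M1 M2 | meet_join p == meet_join (D0, E0)]|
    <= #|detached (symdiff D0 E0)|.
Proof.
move=> [tot1 anti1 tr1 ext1] [tot2 anti2 tr2 ext2] neq.
set S := symdiff D0 E0; pose B := detached S; pose mk := complete D0 E0.
pose F := [set X in B | M1 (mk X) (mk (S :\: X))].
pose G := [set X in B | M2 (mk (S :\: X)) (mk X)].
have SX0 X : X \in B -> mk X != mk (S :\: X).
  move=> BX; apply: contraNneq neq => /complete_inj;
    rewrite detachedC // => /(_ BX isT) /setP e.
  have : S == set0 by apply/eqP/setP=> z; have := e z; rewrite !inE;
    case: (z \in X) => //= <-.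
  by rewrite symdiff_eq0.
have DK X : X \in B -> S :\: (S :\: X) = X.
  case/detachedP=> /subsetP sX _; apply/setP=> z; have := sX z; rewrite !inE.
  by case: (z \in X) => [->|_] //=; rewrite andNb.
have BC X : X \in B -> X \subset S /\ S :\: X \in B.
  by move=> BX; split; [case/detachedP: BX | apply: detachedC].
have FB : F \subset B by apply/subsetP=> X; rewrite inE => /andP[].
have GB : G \subset B by apply/subsetP=> X; rewrite inE => /andP[].
have hF : 2 * #|F| <= #|B|.
  apply: (card_half BC FB) => X; rewrite inE => /andP[BX hX].
  rewrite inE (DK X) //; apply/negP=> /andP[_ hX']; case/eqP: (SX0 X BX).
  by apply: anti1; rewrite hX.
have hG : 2 * #|G| <= #|B|.
  apply: (card_half BC GB) => X; rewrite inE => /andP[BX hX].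
  rewrite inE (DK X) //; apply/negP=> /andP[_ hX']; case/eqP: (SX0 X BX).
  by apply: anti2; rewrite hX hX'.
(* Shrinking [X] shrinks the first downset and enlarges the second, and [M1] respects inclusion. *)
have dF : closed_below B F.
  move=> X Y BX BY XY /setIdP[_ hY]; rewrite inE BX /=.
  apply: (tr1 (mk Y)); first by apply/ext1/complete_subset.
  by apply: tr1 hY _; apply/ext1/complete_subset; rewrite ?detachedC // setDS.
have uG : closed_above B G.
  move=> X Y BX BY XY /setIdP[_ hX]; rewrite inE BY /=.
  apply: (tr2 (mk X)); last by apply/ext2/complete_subset.
  by apply: tr2 hX; apply/ext2/complete_subset; rewrite ?detachedC // setDS.
have kl := kleitman (@detached_ring S) FB GB dF uG.
have B0 : 0 < #|B| by apply/card_gt0P; exists S; apply: detached_full.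
have le : #|[set p in inversions M1 M2 | meet_join p == meet_join (D0, E0)]| <= #|F :&: G|.
  pose f (p : downset P * downset P) := (p.1 : {set P}) :\: p.2.
  rewrite -(card_in_imset (f := f)); last first.
    move=> [D E] [D' E']; rewrite !inE /= => /andP[_ /eqP e] /andP[_ /eqP e'] eqf.
    have [eD eE] := complete_setD e; have [eD' eE'] := complete_setD e'.
    by rewrite /f /= in eqf; congr (_, _); [rewrite -eD eqf | rewrite -eE eqf].
  apply/subset_leq_card/subsetP=> _ /imsetP[[D E] + ->].
  rewrite [in X in X -> _]inE [in X in X -> _]inE /= =>
    /andP[/and3P[_ h1 h2] /eqP e].
  have [eD eE] := complete_setD e.
  have BX : f (D, E) \in B by rewrite /B /S -(meet_join_symdiff e);
    apply: setD_detached.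
  by apply/setIP; split; apply/setIdP; split; rewrite // /mk eD eE.
rewrite -/B; move: le kl hF hG B0.
move: #|_| #|B| #|F :&: G| #|F| #|G| => a n k f g le kl hF hG n0.
(* The chain is [4 a n <= 4 n k <= (2 f) (2 g) <= n n], after which [n] cancels. *)
rewrite -(leq_pmul2l n0); apply: leq_trans (leq_mul hF hG).
rewrite mulnACA mulnCA leq_mul2l /=.
by apply: leq_trans kl; rewrite leq_mul2l le orbT.
Qed.

Lemma card_inversions_fibre_ge s t D0 E0 :
    realizer2 s t -> ~~ (D0 <= E0)%O -> ~~ (E0 <= D0)%O ->
  #|detached (symdiff D0 E0)| <=
    4 * #|[set p in inversions (downset_linext s) (downset_linext t) |
            meet_join p == meet_join (D0, E0)]|.
Proof.
move=> real nDE nED; have [ls lt rel] := real.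
have neq : D0 != E0 by apply: contraNneq nDE => ->.
have [x xS mx] := symdiff_max ls neq; have [y yS my] := symdiff_max lt neq.
set S := symdiff D0 E0.
(* Incomparability of [D0] and [E0] makes their difference a nonempty proper union of components of
   [S]. *)
have W0 : (D0 : {set P}) :\: E0 != set0 by rewrite setD_eq0.
have WS : (D0 : {set P}) :\: E0 != S.
  apply: contra nED => /eqP/setP e.
  rewrite -[(_ <= _)%O]/((E0 : {set P}) \subset D0); apply/subsetP=> z zE.
  by have := e z; rewrite in_symdiff !inE zE /= addbT => /esym/negbFE.
have [X0 [B0 y0 x0]] := detached_separation real (setD_detached D0 E0) xS yS mx my W0 WS.
rewrite (card_separated xS B0 y0 x0) leq_mul2l /=.
(* For [X] containing [y] but not [x], the second downset wins at [x] under [s] and the first at [y]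
   under [t], so the pair is reversed. *)
pose g X := (complete D0 E0 X, complete D0 E0 (S :\: X)).
rewrite -(card_in_imset (f := g)); last first.
  move=> X Y; rewrite [in X in X -> _]inE [in X in _ -> X -> _]inE.
  by move=> /andP[BX _] /andP[BY _] [/complete_inj -> //].
apply/subset_leq_card/subsetP=> _ /imsetP[X + ->].
rewrite [in X in X -> _]inE => /and3P[BX yX xX].
have mj := meet_join_complete BX; rewrite inE mj eqxx andbT.
have eS := meet_join_symdiff mj; rewrite /= in eS.
have nC z : z \in S -> z \notin (D0 : {set P}) :&: E0.
  by rewrite in_symdiff inE; case: (z \in _); case: (z \in _).
have h1 : x \in (complete D0 E0 (S :\: X) : {set P}).
  by rewrite completeE ?detachedC // !in_setU in_setD xX xS orbT.
have h2 : y \in (complete D0 E0 X : {set P})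
  by rewrite completeE // in_setU yX orbT.
rewrite inE /=; apply/and3P; split.
- apply: contraTneq h2 => ->; rewrite completeE ?detachedC //.
  by rewrite in_setU in_setD yX orbF; apply: nC.
- by rewrite (downset_linextE (x := x) ls) ?eS.
- by rewrite (downset_linextE (x := y) lt) // symdiffC eS.
Qed.

End DownsetOrder.

(** * Comparing the distances fibre by fibre *)

Theorem theorem4 (d : Order.disp_t) (P : finPOrderType d) (s sbar : rel P)
    (dim2 : two_dimensional P) (diam : diametral_pair s sbar) :
  diametral_pair (downset_linext s) (downset_linext sbar).
Proof.
have real := diametral_realizer dim2 diam; have [ls lt _] := real.
have lls := downset_linext_linear ls; have llt := downset_linext_linear lt.
split; [exact: lls | exact: llt | move=> M1 M2 lM1 lM2].
have [_ anti_s _ _] := lls; have [_ anti1 _ ext1] := lM1;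
  have [_ anti2 _ ext2] := lM2.
rewrite (linext_distE M2 anti1) (linext_distE _ anti_s).
rewrite !(card_fibres (@meet_join d P)); apply: leq_sum => cu _.
(* A fibre without inversions of [M1], [M2] is trivial; otherwise a reversed pair, necessarily
   incomparable, serves as its base point. *)
have [/existsP[[D0 E0] /andP[+ /eqP <-]]|] :=
    boolP [exists p, (p \in inversions M1 M2) && (meet_join p == cu)]; last first.
  rewrite negb_exists => /forallP no; apply: leq_trans (leq0n _).
  rewrite leqn0 cards_eq0; apply/eqP/setP=> p.
  by rewrite inE (negPf (no p)) inE.
rewrite inE /= => /and3P[neq h1 h2].
have nDE : ~~ (D0 <= E0)%O.
  by apply: contra neq => le; apply/eqP/anti2; rewrite h2 ext2.
have nED : ~~ (E0 <= D0)%O.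
  by apply: contra neq => le; apply/eqP/anti1; rewrite h1 ext1.
rewrite -(leq_pmul2l (isT : 0 < 4)).
apply: leq_trans (card_inversions_fibre_le lM1 lM2 neq) _.
exact: card_inversions_fibre_ge.
Qed.
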